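(* There is an algorithm which, given a finite poset $P=(X,\prec)$ with $|X|=n$ elements, distinct elements $x_1,\dots,x_k\in X$ and distinct integers $a_1,\dots,a_k\in\{1,\dots,n\}$, decides whether $N(a_1,\dots,a_k)=0$ in time polynomial in $n$, where $N(a_1,\dots,a_k)$ is the number of linear extensions $L$ of $P$ such that $L(x_i)=a_i$ for all $1\le i\le k$.
   Context: A linear extension of $P$ is a bijection $L:X\to\{1,\dots,n\}$ with $L(u)<L(v)$ whenever $u\prec v$. The poset is assumed to be presented so that each comparison query ''is $u\prec v$?'' costs $O(1)$ time. *)

(* Defs.v *)
From HB Require Import structures.
From mathcomp Require Import all_boot all_order all_algebra.

Set Implicit Arguments.
Unset Strict Implicit.
Unset Printing Implicit Defensive.

Import Order.TTheory.

(* The value set {1, ..., n} is represented by 'I_n, the ordinal [j] standing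
   for the integer [j.+1]. *)
Definition is_linext (disp : Order.disp_t) (X : finPOrderType disp)
    (L : {ffun X -> 'I_#|X|}) : bool :=
  [&& injectiveb L,
      [forall j, exists u, L u == j]
    & [forall u : X, forall v : X, (u < v)%O ==> (L u < L v)%N]].

Definition num_linext_at (disp : Order.disp_t) (X : finPOrderType disp)
    (k : nat) (x : k.-tuple X) (a : k.-tuple nat) : nat :=
  #|[set L : {ffun X -> 'I_#|X|} |
      is_linext L & [forall i : 'I_k, (L (tnth x i)).+1 == tnth a i]]|.

(* Unit-cost random access machine with the instruction set of Cook and Reckhow
   (addition and subtraction only, so that running time is polynomially related
   to that of Turing machines), without input and output instructions and with
   a comparison query of cost 1.  A program uses finitely many directly addressed
   registers and an indirectly addressed memory; both hold natural numbers, and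
   subtraction is truncated. *)
Inductive instr : Type :=
| IConst (r c : nat)
| IAdd (r i j : nat)
| ISub (r i j : nat)
| ILoad (r i : nat)
| IStore (i j : nat)
| IJumpPos (i l : nat)
| IQuery (r i j : nat)
| IHalt.

Definition program : Type := seq instr.

Record state : Type := State {
  pc : nat;
  regs : nat -> nat;
  memory : nat -> nat
}.

Definition set_reg (s : state) (r v : nat) : state :=
  State (pc s).+1 [eta regs s with r |-> v] (memory s).

Definition set_mem (s : state) (p v : nat) : state :=
  State (pc s).+1 (regs s) [eta memory s with p |-> v].

Definition goto (s : state) (l : nat) : state := State l (regs s) (memory s).

(* Running past the end of the program halts. *)
Definition cur_instr (p : program) (s : state) : instr := nth IHalt p (pc s).

Definition halted (p : program) (s : state) : bool :=
  if cur_instr p s is IHalt then true else false.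

Definition step (p : program) (query : rel nat) (s : state) : state :=
  let R := regs s in
  match cur_instr p s with
  | IConst r c => set_reg s r c
  | IAdd r i j => set_reg s r (R i + R j)
  | ISub r i j => set_reg s r (R i - R j)
  | ILoad r i => set_reg s r (memory s (R i))
  | IStore i j => set_mem s (R i) (R j)
  | IJumpPos i l => goto s (if 0 < R i then l else (pc s).+1)
  | IQuery r i j => set_reg s r (query (R i) (R j))
  | IHalt => s
  end.

Definition run (p : program) (query : rel nat) (t : nat) (s : state) : state :=
  iter t (step p query) s.

(* The machine sees the elements of X through labels 0, ..., n-1.  The query is
   false on numbers that are not labels. *)
Definition poset_query (disp : Order.disp_t) (X : finPOrderType disp)
    (lab : X -> 'I_#|X|) : rel nat :=
  fun i j => [exists u : X, exists v : X,
    [&& lab u == i :> nat, lab v == j :> nat & (u < v)%O]].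

(* R[0] = n, R[1] = k, and M starts with lab x_1, ..., lab x_k, a_1, ..., a_k;
   all other cells are 0. *)
Definition input_state (disp : Order.disp_t) (X : finPOrderType disp)
    (lab : X -> 'I_#|X|) (k : nat) (x : k.-tuple X) (a : k.-tuple nat) : state :=
  State 0 (nth 0 [:: #|X|; k])
          (nth 0 ([seq nat_of_ord (lab u) | u <- x] ++ tval a)).

(* The answer is read off register 0 once the machine has halted. *)
Definition decides_within (p : program) (query : rel nat) (s : state)
    (T : nat) (b : bool) : Prop :=
  exists t : nat,
    [/\ t <= T, halted p (run p query t s) & regs (run p query t s) 0 = b].

(* Main.v *)
(* Each constraint L(x_i) = a_i forces every u >= x_i to a late enough position
   and every u <= x_i to an early enough one, so u gets a release time and a
   deadline, both monotone along the order.  A pinned linear extension exists iff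
   for all s and t at most t - s elements are confined to the positions
   s, ..., t - 1: this is clearly necessary, and under this condition
   earliest-deadline-first scheduling succeeds, the resulting schedule being a
   linear extension because release times and deadlines are monotone.  The
   condition is tested by four nested loops, over s, t, u and i. *)
Require Import Defs.
From HB Require Import structures.
From mathcomp Require Import all_boot all_order all_algebra zify.

Set Implicit Arguments.
Unset Strict Implicit.
Unset Printing Implicit Defensive.

Import Order.TTheory.

(** * Earliest-deadline-first scheduling of unit jobs *)

(** Induction on the number [m] of slots left from [s0] on: slot [s0] receives the available job of
    least [key], or stays idle, and the other releases are raised to [s0.+1]. [key] refines the
    deadlines. *)
Lemma earliest_deadline_first (T : finType) (N : nat) (d key : T -> nat) :
    (forall u, d u <= N) -> (forall u v, key u <= key v -> d u <= d v) ->
  forall (m s0 : nat) (J : {set T}) (r : T -> nat),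
    N = s0 + m -> (forall u, u \in J -> s0 <= r u) ->
    (forall s t, s <= N -> t <= N ->
       #|[set u in J | (s <= r u) && (d u <= t)]| <= t - s) ->
  exists L : T -> nat,
    [/\ forall u, u \in J -> r u <= L u < d u, {in J &, injective L} &
        {in J &, forall u v, r u <= r v -> key u < key v -> L u < L v}].
Proof.
move=> dN keyd; elim=> [|m IH] s0 J r eN s0r HJ.
  have J0 u : u \in J -> False.
    (* Every job would be confined to the empty interval from [N] to [N]. *)
    move=> uJ; have := HJ N N (leqnn _) (leqnn _); rewrite subnn leqn0 cards_eq0.
    move/eqP/setP/(_ u); rewrite !inE uJ dN andbT /=.
    by have := s0r u uJ; rewrite eN addn0 => ->.
  exists (fun=> 0); split=> [u|u v|u v] /J0 //.
have [|nJ] := pickP [pred u | (u \in J) && (r u <= s0)]; last first.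
  apply: (IH s0.+1 J r) => //; first by rewrite eN addSnnS.
  by move=> u uJ; have := nJ u; rewrite inE uJ /= ltnNge => ->.
move=> u0 /= u0P.
have [w /andP[wJ rw] wmin] :=
  arg_minnP (P := [pred u | (u \in J) && (r u <= s0)]) key u0P.
have dw : s0 < d w.
  rewrite -subn_gt0; apply: leq_trans (HJ s0 (d w) _ (dN _)); last by lia.
  by apply/card_gt0P; exists w; rewrite !inE wJ s0r //= leqnn.
have [||s t sN tN|L' [L'b L'inj L'key]] :=
  IH s0.+1 (J :\ w) (fun u => maxn (r u) s0.+1).
- by rewrite eN addSnnS.
- by move=> *; rewrite leq_maxr.
- case: (leqP s s0.+1) => hs; last first.
    apply: leq_trans (HJ s t sN tN); apply: subset_leq_card.
    by apply/subsetP=> u; rewrite !inE; lia.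
  (* If [t < d w], a job due by [t] cannot be available at [s0], by the choice of [w], so raising
     releases does not affect it. *)
  have [le_dt|lt_td] := leqP (d w) t; last first.
    apply: (@leq_trans (t - s0.+1)); last lia.
    have s0N : s0.+1 <= N by lia.
    apply: leq_trans (HJ s0.+1 t s0N tN); apply: subset_leq_card.
    apply/subsetP=> u; rewrite !inE => /andP[/andP[uw uJ] /andP[_ dut]].
    rewrite uJ dut andbT /= ltnNge; apply/negP => ru.
    have := keyd w u (wmin u _); rewrite /= uJ ru => /(_ isT); lia.
  (* Now [w] is itself confined to the slots from [s0] to [t]; removing it makes up for the lost
     slot. *)
  have s0N : s0 <= N by lia.
  have := HJ s0 t s0N tN; rewrite (cardsD1 w) !inE wJ s0r //= le_dt /= => H.
  apply: (@leq_trans (t - s0).-1); last lia.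
  suff : #|[set u in J :\ w | (s <= maxn (r u) s0.+1) && (d u <= t)]| <=
         #|[set u in J | (s0 <= r u) && (d u <= t)] :\ w| by lia.
  apply: subset_leq_card; apply/subsetP=> u; rewrite !inE.
  by case/andP=> /andP[-> uJ] /andP[_ ->]; rewrite uJ s0r.
have gtL u : u \in J -> u != w -> s0 < L' u /\ r u <= L' u < d u.
  move=> uJ uw; have := L'b u; rewrite !inE uw uJ => /(_ isT); lia.
exists (fun u => if u == w then s0 else L' u); split=> [u uJ|u v uJ vJ|u v uJ vJ].
- by case: eqVneq => [->|/gtL[//|]]; [rewrite dw rw|].
- case: (eqVneq u w) => [->|uw]; case: (eqVneq v w) => [->//|vw].
  + by have [] := gtL v vJ vw; lia.
  + by have [] := gtL u uJ uw; lia.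
  + by apply: L'inj; rewrite !inE ?uw ?vw.
- move=> ruv kuv; case: (eqVneq u w) => [eu|uw]; case: (eqVneq v w) => [ev|vw].
  + by rewrite eu ev ltnn in kuv.
  + by have [] := gtL v vJ vw.
  (* Here [u] would be available at [s0] with a smaller key than [w]. *)
  + have := wmin u; rewrite /= uJ -ev; move: kuv ruv rw; rewrite -ev; lia.
  + by apply: L'key; rewrite ?inE ?uw ?vw //; lia.
Qed.

Lemma leq_bigmaxE (I : finType) (P : pred I) (F : I -> nat) (s : nat) :
  (s <= \max_(i | P i) F i) = (s == 0) || [exists i, P i && (s <= F i)].
Proof.
case: s => [|s] //=; apply/idP/existsP => [|[i /andP[Pi lt_sF]]]; last first.
  exact: leq_trans lt_sF (leq_bigmax_cond _ Pi).
rewrite ltnNge => /bigmax_leqP nle; apply/existsP; apply: contra_notT nle.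
rewrite negb_exists => /forallP H i Pi; have := H i; rewrite Pi /=; lia.
Qed.

(** * Pinned linear extensions and the interval condition *)

Section PinnedExtensions.
Variables (disp : Order.disp_t) (X : finPOrderType disp) (k : nat).
Variables (x : k.-tuple X) (a : k.-tuple nat).
Local Notation n := #|X|.

(* Positions are counted from 0 as in ['I_n], whereas the [a_i] are counted
   from 1. *)
Definition forced_from (s : nat) (u : X) : bool :=
  (s == 0) ||
  [exists i : 'I_k, (tnth x i <= u)%O && (s < tnth a i + (tnth x i < u)%O)].

Definition forced_before (t : nat) (u : X) : bool :=
  (n <= t) ||
  [exists i : 'I_k, (u <= tnth x i)%O && (tnth a i <= t + (u < tnth x i)%O)].

Definition release (u : X) : nat :=
  \max_(i < k | (tnth x i <= u)%O) ((tnth a i).-1 + (tnth x i < u)%O).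

(** An exclusive upper bound: the minimum of [n] and the individual bounds, written through
    complements so that an empty family gives [n]. *)
Definition deadline (u : X) : nat :=
  n - \max_(i < k | (u <= tnth x i)%O) (n - (tnth a i - (u < tnth x i)%O)).

Definition interval_condition : bool :=
  [forall s : 'I_n.+1, forall t : 'I_n.+1,
     #|[set u | forced_from s u && forced_before t u]| <= t - s].

Lemma release_mono u v : (u < v)%O -> release u <= release v.
Proof.
move=> uv; apply/bigmax_leqP => i xu; have xv := le_lt_trans xu uv.
apply: leq_trans (_ : (tnth a i).-1 + (tnth x i < v)%O <= _).
  by rewrite xv leq_add2l leq_b1.
by rewrite leq_bigmaxE; apply/orP; right; apply/existsP; exists i; rewrite ltW /=.
Qed.

Lemma deadline_mono u v : (u < v)%O -> deadline u <= deadline v.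
Proof.
move=> uv; apply: leq_sub2l; apply/bigmax_leqP => i vx.
have ux := lt_le_trans uv vx.
apply: leq_trans (_ : n - (tnth a i - (u < tnth x i)%O) <= _).
  by rewrite ux; case: (v < _)%O; lia.
by rewrite leq_bigmaxE; apply/orP; right; apply/existsP; exists i; rewrite ltW /=.
Qed.

Hypothesis a_range : all (fun b => 1 <= b <= n) a.

Lemma tnth_range i : 1 <= tnth a i <= n.
Proof. by move/allP: a_range; apply; apply: mem_tnth. Qed.

Lemma forced_fromE s u : forced_from s u = (s <= release u).
Proof.
rewrite leq_bigmaxE; congr orb; apply: eq_existsb => i; congr andb.
by have := tnth_range i; lia.
Qed.

Lemma forced_beforeE t u : forced_before t u = (deadline u <= t).
Proof.
rewrite /forced_before /deadline leq_subCl leq_bigmaxE subn_eq0.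
have [//|lt_tn /=] := leqP n t; apply: eq_existsb => i; congr andb.
move: lt_tn (tnth_range i); move: #|X| (tnth a i) => N b.
by case: (u < _)%O => /=; lia.
Qed.

Lemma interval_condition_necessary :
  0 < num_linext_at x a -> interval_condition.
Proof.
case/card_gt0P=> L; rewrite inE => /andP[/and3P[/injectiveP Linj _ Lmono] Lx].
have {}Lmono u v : (u < v)%O -> L u < L v.
  by move: Lmono => /forallP/(_ u)/forallP/(_ v)/implyP.
have {}Lx i : (L (tnth x i)).+1 = tnth a i by apply/eqP; move/forallP: Lx.
have from s u : forced_from s u -> s <= L u.
  case/orP=> [/eqP->//|/existsP[i /andP[]]]; rewrite -Lx le_eqVlt.
  case/orP=> [/eqP->|xu]; first by rewrite ltxx; lia.
  by have := Lmono _ _ xu; rewrite xu; lia.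
have before t u : forced_before t u -> L u < t.
  case/orP=> [|/existsP[i /andP[]]]; first exact: leq_trans.
  rewrite -Lx le_eqVlt.
  case/orP=> [/eqP->|ux]; first by rewrite ltxx; lia.
  by have := Lmono _ _ ux; rewrite ux; lia.
apply/forallP=> s; apply/forallP=> t.
(* [L] injects the confined elements into the [t - s] positions from [s] on. *)
rewrite -(card_imset _ Linj) cardE -(size_iota s (t - s)) -(size_map val).
apply: uniq_leq_size; first by rewrite map_inj_uniq ?enum_uniq //; apply: val_inj.
move=> _ /mapP[_ /[!mem_enum] /imsetP[u /[!inE] /andP[/from su /before ut] ->] ->].
by rewrite mem_iota su subnKC // ltnW // (leq_ltn_trans su).
Qed.

(* Breaking ties between equal deadlines by the height of an element in the
   order makes the earliest-deadline-first schedule a linear extension. *)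
Lemma interval_condition_sufficient :
  interval_condition -> 0 < num_linext_at x a.
Proof.
move=> cond; pose ht (u : X) := #|[set w | (w < u)%O]|.
have ht_lt u : ht u <= n by apply: max_card.
have ht_mono u v : (u < v)%O -> ht u < ht v.
  move=> uv; apply: proper_card; apply/properP; split.
    by apply/subsetP=> w; rewrite !inE => /lt_trans; apply.
  by exists u; rewrite !inE ?ltxx.
(* Lexicographic order on deadline, then height: heights are below the base [n.+1]. *)
pose key u := deadline u * n.+1 + ht u.
have dn u : deadline u <= n by apply: leq_subr.
have keyd u v : key u <= key v -> deadline u <= deadline v.
  move=> kuv; rewrite leqNgt; apply/negP => dvu.
  have : (deadline v).+1 * n.+1 <= deadline u * n.+1 by rewrite leq_mul2r dvu orbT.
  by rewrite mulSn; move: kuv (ht_lt u) (ht_lt v); rewrite /key; lia.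
have [||s t sn tn|L [Lb Linj Lkey]] :=
  earliest_deadline_first dn keyd (m := n) (s0 := 0) (J := [set: X]) (r := release).
- by [].
- by [].
- move/forallP/(_ (Ordinal (sn : s < n.+1))): (cond).
  move/forallP/(_ (Ordinal (tn : t < n.+1))).
  rewrite /=; congr (_ <= _); apply: eq_card => u.
  by rewrite !inE forced_fromE forced_beforeE.
have {}Lb u : release u <= L u < deadline u by apply: Lb.
have Ln u : L u < n by have := Lb u; have := dn u; lia.
pose F := [ffun u => Ordinal (Ln u)].
have Finj : injective F.
  by move=> u v /(congr1 val); rewrite !ffunE /=; apply: Linj.
apply/card_gt0P; exists F; rewrite inE; apply/andP; split; last first.
  (* Release and deadline of a pinned element leave it a single slot. *)
  apply/forallP=> i; rewrite ffunE /=; have := Lb (tnth x i).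
  have from : (tnth a i).-1 <= release (tnth x i).
    rewrite -forced_fromE; apply/orP; right; apply/existsP; exists i.
    by rewrite lexx ltxx; have := tnth_range i; lia.
  have before : deadline (tnth x i) <= tnth a i.
    rewrite -forced_beforeE; apply/orP; right; apply/existsP; exists i.
    by rewrite lexx ltxx addn0 /=.
  by have := tnth_range i; lia.
apply/and3P; split; first exact/injectiveP.
  apply/forallP=> j; apply/existsP.
  have /codomP[u ->] : j \in codom F by apply: inj_card_onto; rewrite ?card_ord.
  by exists u.
apply/forallP=> u; apply/forallP=> v; apply/implyP=> uv; rewrite !ffunE /=.
apply: Lkey; rewrite ?inE ?release_mono //.
rewrite /key -addnS leq_add ?ht_mono //.
by rewrite leq_mul2r deadline_mono ?orbT.
Qed.

Lemma num_linext_at_eq0 : (num_linext_at x a == 0) = ~~ interval_condition.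
Proof.
apply/idP/idP => [|/negP nc].
  by apply: contraL => /interval_condition_sufficient; rewrite lt0n.
by rewrite -leqn0 leqNgt; apply/negP => /interval_condition_necessary.
Qed.

End PinnedExtensions.

(* Registers: 0 = n, 1 = k, 2 = 1, 3 = 0, 4 = s, 5 = t, 6 = u, 7 = number of
   elements confined to [s, t[ found so far, 8 = i, 9 (resp. 10) > 0 iff some
   constraint forces u to a position >= s (resp. < t), 11 and above = scratch.
   The four nested loops count s, t, u, i down; their tests are at 2, 7, 12, 24.
   Jump targets are absolute, and the targeted lines are numbered.  The truth
   values of comparisons and conjunctions come from truncated subtraction, e.g.
   b - (c - d) > 0 iff b = 1 and c <= d, for b <= 1; in the inner loop b may be
   a sum of two exclusive flags. *)
Definition interval_program : program :=
  [::          IConst 2 1;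
               IAdd 4 0 2;
      (*  2 *) IJumpPos 4 5;
               IConst 0 0;
               IHalt;
      (*  5 *) ISub 4 4 2;
               IAdd 5 0 2;
      (*  7 *) IJumpPos 5 9;
               IJumpPos 2 2;
      (*  9 *) ISub 5 5 2;
               IConst 7 0;
               IAdd 6 0 3;
      (* 12 *) IJumpPos 6 19;
               ISub 11 5 4;
               ISub 11 7 11;
               IJumpPos 11 17;
               IJumpPos 2 7;
      (* 17 *) IConst 0 1;
               IHalt;
      (* 19 *) ISub 6 6 2;
               ISub 9 2 4;
               IAdd 10 5 2;
               ISub 10 10 0;
               IAdd 8 1 3;
      (* 24 *) IJumpPos 8 31;
               ISub 11 2 9;
               ISub 12 2 10;
               IAdd 11 11 12;
               ISub 11 2 11;
               IAdd 7 7 11;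
               IJumpPos 2 12;
      (* 31 *) ISub 8 8 2;
               ILoad 11 8;
               IAdd 12 8 1;
               ILoad 12 12;
               IQuery 13 11 6;
               IQuery 14 6 11;
               ISub 15 11 6;
               ISub 16 6 11;
               IAdd 15 15 16;
               ISub 15 2 15;
               IAdd 16 12 13;
               IAdd 17 4 2;
               ISub 16 17 16;
               IAdd 17 13 15;
               ISub 16 17 16;
               IAdd 9 9 16;
               IAdd 16 5 14;
               ISub 16 12 16;
               IAdd 17 14 15;
               ISub 16 17 16;
               IAdd 10 10 16;
               IJumpPos 2 24].

(** * Execution and running time of the program *)

Lemma runS p query t s :
  run p query t.+1 s = run p query t (step p query s).
Proof. exact: iterSr. Qed.

Lemma all_iotaS (P : pred nat) m :
  all P (iota 0 m.+1) = P m && all P (iota 0 m).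
Proof. by rewrite -addn1 iotaD all_cat /= andbT andbC. Qed.

Arguments run : simpl never.

Section Execution.
Variables (query : rel nat) (M : nat -> nat) (n k : nat).
Local Notation prog := interval_program.

(** Only an initial segment of the registers is described, which leaves scratch values free. *)
Definition at_line (l : nat) (vals : seq nat) (s : state) : Prop :=
  [/\ pc s = l, memory s = M & mkseq (regs s) (size vals) = vals].

Definition leads_to (T l : nat) (vals : seq nat) (l' : nat) (vals' : seq nat) :
    Prop :=
  forall s, at_line l vals s ->
    exists2 t, t <= T & at_line l' vals' (run prog query t s).

Lemma leads_to_trans T1 T2 T l1 v1 l2 v2 l3 v3 :
  leads_to T1 l1 v1 l2 v2 -> leads_to T2 l2 v2 l3 v3 -> T1 + T2 <= T ->
  leads_to T l1 v1 l3 v3.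
Proof.
move=> H1 H2 leT s /H1[t1 le1 /H2[t2 le2 H]]; exists (t2 + t1); first by lia.
by rewrite /run iterD.
Qed.

Definition same_label (v w : nat) : nat := 1 - (v - w + (w - v)).

(** Mirrors the arithmetic of the inner loop; for a poset query on labels it is positive exactly
    when constraint [j] forces [u] to a position at least [s], if [s > 0]. *)
Definition from_weight (s u j : nat) : nat :=
  query (M j) u + same_label (M j) u - (s + 1 - (M (j + k) + query (M j) u)).

Definition before_weight (t u j : nat) : nat :=
  query u (M j) + same_label (M j) u - (M (j + k) - (t + query u (M j))).

Definition from_total (s u : nat) : nat :=
  1 - s + \sum_(j < k) from_weight s u j.

Definition before_total (t u : nat) : nat :=
  t + 1 - n + \sum_(j < k) before_weight t u j.

Definition counted (s t u : nat) : nat :=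
  1 - (1 - from_total s u + (1 - before_total t u)).

Definition interval_ok (s t : nat) : bool :=
  \sum_(u < n) counted s t u <= t - s.

Ltac exec E :=
  repeat (rewrite runS /step /cur_instr /set_reg /goto /= ?E ?subn1 /=);
  rewrite /run /at_line /mkseq /= ?E.

(** Induction on the counter with arbitrary accumulators; a pass takes 23 instructions, and the
    final [1] is the failing test. *)
Lemma constraint_loop s t u c i A B :
  leads_to (23 * i + 1) 24 [:: n; k; 1; 0; s; t; u; c; i; A; B]
    25 [:: n; k; 1; 0; s; t; u; c; 0; A + \sum_(j < i) from_weight s u j;
           B + \sum_(j < i) before_weight t u j].
Proof.
elim: i A B => [|i IH] A B.
  case=> ? R ? [/= -> -> [e0 e1 e2 e3 e4 e5 e6 e7 e8 e9 e10]].
  exists 1 => //; exec (e0, e1, e2, e3, e4, e5, e6, e7, e8, (e9, e10)).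
  by rewrite !big_ord0 !addn0.
rewrite !big_ord_recr /= ![\sum_(_ < _) _ + _]addnC !addnA.
apply: leads_to_trans (IH _ _) _; last by rewrite mulnS addnA.
case=> ? R ? [/= -> -> [e0 e1 e2 e3 e4 e5 e6 e7 e8 e9 e10]].
by exists 23 => //; exec (e0, e1, e2, e3, e4, e5, e6, e7, e8, (e9, e10)).
Qed.

Lemma element_loop s t u c :
  leads_to (u * (23 * k + 13) + 1) 12 [:: n; k; 1; 0; s; t; u; c]
    13 [:: n; k; 1; 0; s; t; 0; c + \sum_(v < u) counted s t v].
Proof.
elim: u c => [|u IH] c.
  case=> ? R ? [/= -> -> [e0 e1 e2 e3 e4 e5 e6 e7]].
  exists 1 => //; exec (e0, e1, e2, e3, e4, e5, e6, e7).
  by rewrite big_ord0 addn0.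
rewrite big_ord_recr /= [\sum_(_ < _) _ + _]addnC addnA.
apply: (@leads_to_trans (23 * k + 13) _ _ _ _ _ _ _ _ _ (IH _));
  last by rewrite mulSn addnA.
  apply: (@leads_to_trans 6 (23 * k + 7) _ _ _
            24 [:: n; k; 1; 0; s; t; u; c; k; 1 - s; t + 1 - n]); last lia.
    case=> ? R ? [/= -> -> [e0 e1 e2 e3 e4 e5 e6 e7]].
    by exists 6 => //; exec (e0, e1, e2, e3, e4, e5, e6, e7, addn0).
  apply: leads_to_trans (@constraint_loop _ _ _ _ _ _ _) _
    (_ : 23 * k + 1 + 6 <= _); last lia.
  case=> ? R ? [/= -> -> [e0 e1 e2 e3 e4 e5 e6 e7 e8 e9 e10]].
  by exists 6 => //; exec (e0, e1, e2, e3, e4, e5, e6, e7, e8, (e9, e10)).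
Qed.

Definition position_step_cost : nat := n * (23 * k + 13) + 9.

(** The conditionals record the early exit to 17 at a violated interval, where register contents no
    longer matter. *)
Lemma upper_loop s t :
  leads_to (t * position_step_cost + 2) 7 [:: n; k; 1; 0; s; t]
    (if all (interval_ok s) (iota 0 t) then 2 else 17)
    (if all (interval_ok s) (iota 0 t) then [:: n; k; 1; 0; s] else [::]).
Proof.
elim: t => [|t IH].
  case=> ? R ? [/= -> -> [e0 e1 e2 e3 e4 e5]].
  by exists 2 => //; exec (e0, e1, e2, e3, e4, e5).
rewrite !all_iotaS.
apply: (@leads_to_trans (n * (23 * k + 13) + 5) (t * position_step_cost + 6) _ _ _
          13 [:: n; k; 1; 0; s; t; 0; \sum_(u < n) counted s t u]); last first.
- by rewrite /position_step_cost mulSn; lia.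
- have [ok|nok] /= := boolP (interval_ok s t).
    apply: (leads_to_trans _ IH); last by rewrite -[6]/(4 + 2) addnCA.
    case=> ? R ? [/= -> -> [e0 e1 e2 e3 e4 e5 e6 e7]].
    have e : (0 < \sum_(u < n) counted s t u - (t - s)) = false.
      by apply/negbTE; rewrite subn_gt0 -leqNgt.
    by exists 4 => //; exec (e, e0, e1, e2, e3, e4, e5, e6, e7).
  case=> ? R ? [/= -> -> [e0 e1 e2 e3 e4 e5 e6 e7]].
  have e : 0 < \sum_(u < n) counted s t u - (t - s) by rewrite subn_gt0 ltnNge.
  exists 3; first by lia.
  by exec (e, e0, e1, e2, e3, e4, e5, e6, e7).
apply: (@leads_to_trans 4 _ _ _ _ 12 [:: n; k; 1; 0; s; t; n; 0]
          _ _ _ (@element_loop _ _ _ _)); last lia.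
case=> ? R ? [/= -> -> [e0 e1 e2 e3 e4 e5]].
by exists 4 => //; exec (e0, e1, e2, e3, e4, e5, addn0).
Qed.

Definition all_ok (s : nat) : bool := all (interval_ok s) (iota 0 n.+1).

Definition bound_step_cost : nat := n.+1 * position_step_cost + 5.

Lemma lower_loop s :
  leads_to (s * bound_step_cost + 1) 2 [:: n; k; 1; 0; s]
    (if all all_ok (iota 0 s) then 3 else 17) [::].
Proof.
elim: s => [|s IH].
  case=> ? R ? [/= -> -> [e0 e1 e2 e3 e4]].
  by exists 1 => //; exec (e0, e1, e2, e3, e4).
rewrite !all_iotaS.
apply: (@leads_to_trans bound_step_cost (s * bound_step_cost + 1));
  last by rewrite mulSn addnA.
  apply: (@leads_to_trans 3 _ _ _ _ 7 [:: n; k; 1; 0; s; n.+1]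
           _ _ _ (@upper_loop _ _)); last by rewrite /bound_step_cost; lia.
  case=> ? R ? [/= -> -> [e0 e1 e2 e3 e4]].
  by exists 3 => //; exec (e0, e1, e2, e3, e4, addn1).
by rewrite -/(all_ok s); case: (all_ok s) => //= z Hz; exists 0.
Qed.

Definition total_cost : nat := n.+1 * bound_step_cost + 4.

Lemma interval_program_decides s :
  at_line 0 [:: n; k; 0; 0] s ->
  decides_within prog query s total_cost (~~ all all_ok (iota 0 n.+1)).
Proof.
have start : leads_to 2 0 [:: n; k; 0; 0] 2 [:: n; k; 1; 0; n.+1].
  case=> ? R ? [/= -> -> [e0 e1 e2 e3]].
  by exists 2 => //; exec (e0, e1, e2, e3, addn1).
have H := leads_to_trans start (@lower_loop _) (leqnn _).
(* The extra step writes the answer to register 0, just before a halt. *)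
case/H=> t let_ [pcE _ _]; exists t.+1.
rewrite {1 2}/run iterS -/(run _ _ _ _).
case: (run _ _ _ _) pcE => /= p R m ->; split.
- by rewrite /total_cost; lia.
- by case: ifP.
- by case: ifP.
Qed.

End Execution.

Lemma total_cost_bound n k : k <= n ->
  total_cost n k <= (Poly [:: 18; 36; 58; 59; 23]).[n]%R.
Proof.
move=> le_kn; rewrite horner_Poly /=.
(* The coefficients are those of [total_cost n n] expanded in [n]. *)
apply: (@leq_trans (total_cost n n)); last first.
  rewrite /total_cost /bound_step_cost /position_step_cost.
  by rewrite /GRing.add /GRing.mul /=; nia.
rewrite leq_add2r leq_mul2l leq_add2r leq_mul2l leq_add2r leq_mul2l leq_add2r.
by rewrite leq_mul2l le_kn !orbT.
Qed.

Lemma lt0_sumE (I : finType) (F : I -> nat) :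
  (0 < \sum_i F i) = [exists i, 0 < F i].
Proof.
rewrite lt0n sum_nat_eq0 negb_forall.
by apply: eq_existsb => i; rewrite /= lt0n.
Qed.

(** * From labels and memory cells back to the poset *)

Section Encoding.
Variables (disp : Order.disp_t) (X : finPOrderType disp) (lab : X -> 'I_#|X|).
Variables (k : nat) (x : k.-tuple X) (a : k.-tuple nat).
Hypothesis lab_bij : bijective lab.
Local Notation n := #|X|.
Local Notation query := (poset_query lab).
Local Notation M := (memory (input_state lab x a)).

Lemma poset_queryE u v : query (lab u) (lab v) = (u < v)%O.
Proof.
apply/existsP/idP => [[u' /existsP[v' /and3P[/eqP eu /eqP ev]]]|uv].
  by rewrite (bij_inj lab_bij (val_inj eu)) (bij_inj lab_bij (val_inj ev)).
by exists u; apply/existsP; exists v; rewrite !eqxx.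
Qed.

Lemma same_labelE u v : same_label (lab u) (lab v) = (u == v) :> nat.
Proof.
rewrite -(inj_eq (bij_inj lab_bij)) -(inj_eq val_inj) /same_label /=.
by case: eqP; lia.
Qed.

Lemma input_element (j : 'I_k) : M j = lab (tnth x j).
Proof.
rewrite /= nth_cat size_map size_tuple ltn_ord (nth_map (tnth x j)) ?size_tuple //.
by rewrite -tnth_nth.
Qed.

Lemma input_position (j : 'I_k) : M (j + k) = tnth a j.
Proof.
by rewrite /= nth_cat size_map size_tuple ltnNge leq_addl addnK -tnth_nth.
Qed.

Lemma from_total_gt0 s u :
  (0 < from_total query M k s (lab u)) = forced_from x a s u.
Proof.
rewrite addn_gt0 subn_gt0 ltnS leqn0 lt0_sumE; congr orb.
apply: eq_existsb => j.
rewrite /from_weight input_element input_position poset_queryE same_labelE.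
rewrite le_eqVlt; case: eqVneq => [->|_] /=; first by rewrite ltxx; lia.
by case: (tnth x j < u)%O; lia.
Qed.

Lemma before_total_gt0 t u :
  (0 < before_total query M n k t (lab u)) = forced_before x a t u.
Proof.
rewrite addn_gt0 subn_gt0 addn1 ltnS lt0_sumE; congr orb.
apply: eq_existsb => j.
rewrite /before_weight input_element input_position poset_queryE same_labelE.
rewrite le_eqVlt eq_sym; case: eqVneq => [->|_] /=; first by rewrite ltxx; lia.
by case: (u < tnth x j)%O; lia.
Qed.

Lemma counted_sum s t :
  \sum_(v < n) counted query M n k s t v =
  #|[set u | forced_from x a s u && forced_before x a t u]|.
Proof.
rewrite (reindex lab); last exact: onW_bij.
rewrite -[RHS]sum1_card [RHS]big_mkcond; apply: eq_bigr => u _.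
rewrite inE -from_total_gt0 -before_total_gt0 /counted.
by case: (from_total _ _ _ _ _) => [|?]; case: (before_total _ _ _ _ _ _) => [|?].
Qed.

Lemma all_ok_interval_condition :
  all (all_ok query M n k) (iota 0 n.+1) = interval_condition x a.
Proof.
have okE s t : interval_ok query M n k s t =
    (#|[set u | forced_from x a s u && forced_before x a t u]| <= t - s).
  by rewrite /interval_ok counted_sum.
apply/allP/forallP => [ok s|cond s].
  apply/forallP=> t; rewrite -okE.
  have in_iota (i : 'I_n.+1) : val i \in iota 0 n.+1 by rewrite mem_iota ltn_ord.
  by have /allP/(_ _ (in_iota t)) := ok _ (in_iota s).
rewrite mem_iota => s_le; apply/allP=> t; rewrite mem_iota => t_le.
by have /forallP/(_ (Ordinal t_le)) := cond (Ordinal s_le); rewrite -okE.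
Qed.

End Encoding.

Theorem theorem9p1 :
  exists (p : program) (q : {poly nat}),
    forall (disp : Order.disp_t) (X : finPOrderType disp)
           (lab : X -> 'I_#|X|) (k : nat) (x : k.-tuple X) (a : k.-tuple nat),
      bijective lab ->
      uniq x ->
      uniq a ->
      all (fun b => 1 <= b <= #|X|) a ->
      decides_within p (poset_query lab) (input_state lab x a)
        (q.[#|X|])%R (num_linext_at x a == 0).
Proof.
exists interval_program, (Poly [:: 18; 36; 58; 59; 23]).
move=> disp X lab k x a lab_bij x_uniq _ a_range.
rewrite num_linext_at_eq0 // -(all_ok_interval_condition x a lab_bij).
(* Distinctness of the pinned elements turns a bound in [n] and [k] into one in [n] alone. *)
have le_kn : k <= #|X| by rewrite -(size_tuple x) -(card_uniqP x_uniq) max_card.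
have [//|t [le_t ? ?]] := @interval_program_decides (poset_query lab)
  (memory (input_state lab x a)) #|X| k (input_state lab x a).
by exists t; split=> //; apply: leq_trans le_t (total_cost_bound le_kn).
Qed.
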